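(* Let $p\ge 1$ and $n_1,\ldots,n_p$ be positive integers, $N=n_1\cdots n_p$, and $k$ a positive integer. Then: (a) $\Sigma^k_{pure}(n_1,\ldots,n_p)$ is a connected, compact subset of $\Sigma(n_1,\ldots,n_p)$. In particular, if $\Sigma^k_{pure}(n_1,\ldots,n_p)\neq\Sigma(n_1,\ldots,n_p)$, then it is not dense in $\Sigma(n_1,\ldots,n_p)$ and its complement in $\Sigma(n_1,\ldots,n_p)$ is (relatively) open. (b) If $k<\dfrac{n_1^2\cdots n_p^2}{1-2p+\sum_{j=1}^p 2n_j}$, then $\Sigma^k_{pure}(n_1,\ldots,n_p)$ has measure $0$ in $\Sigma(n_1,\ldots,n_p)$.
   Context: For a positive integer $w$, a density matrix on $\mathbb{C}^w$ is a $w\times w$ complex Hermitian positive semi-definite matrix of trace $1$; let $\mathcal{DM}(w)$ denote the set of these; a pure state is a density matrix of rank one (an orthogonal projection onto a line). Let $N=n_1\cdots n_p$ and identify $\mathbb{C}^N=\mathbb{C}^{n_1}\otimes\cdots\otimes\mathbb{C}^{n_p}$. A product density matrix is one of the form $A_1\otimes\cdots\otimes A_p$ with $A_i\in\mathcal{DM}(n_i)$; it is a pure product state if every $A_i$ is a pure state. $\Sigma(n_1,\ldots,n_p)\subset\mathcal{DM}(N)$ is the set of separable density matrices, i.e. convex combinations of (finitely many) product density matrices. $\Sigma^k_{pure}(n_1,\ldots,n_p)$ is the set of $A\in\Sigma(n_1,\ldots,n_p)$ that can be written as a convex combination of at most $k$ pure product states (i.e. whose optimal pure state ensemble length is $k$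 or fewer). Measure is $(N^2-1)$-dimensional Lebesgue measure on the real affine hyperplane $\tau_1(N)$ of $N\times N$ complex Hermitian matrices of trace $1$ (which contains $\Sigma(n_1,\ldots,n_p)$). *)

(* Defs.v *)
From HB Require Import structures.
From mathcomp Require Import all_boot all_order all_algebra.
From mathcomp Require Import all_classical all_reals all_analysis.
From mathcomp Require Import complex.
Import numFieldNormedType.Exports.

Set Implicit Arguments.
Unset Strict Implicit.
Unset Printing Implicit Defensive.

Import Order.TTheory GRing.Theory Num.Theory.
Local Open Scope ring_scope.
Local Open Scope classical_set_scope.

Section QuantumDefs.
Variable R : realType.
Local Notation C := (R[i]).

Definition adjmx m n (A : 'M[C]_(m, n)) : 'M[C]_(n, m) := (map_mx (@conjc R) A)^T.

Definition hermitian n (A : 'M[C]_n) : Prop := adjmx A = A.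

(* positive semidefinite: Hermitian and v^* A v >= 0 for all v (order of the
   numeric field C: 0 <= z iff z is a nonnegative real) *)
Definition psd n (A : 'M[C]_n) : Prop :=
  hermitian A /\ forall v : 'cV[C]_n, 0 <= (adjmx v *m A *m v) 0 0.

Definition density n (A : 'M[C]_n) : Prop := psd A /\ \tr A = 1.

Definition pure_state n (A : 'M[C]_n) : Prop := density A /\ \rank A = 1%N.

(* index set of the standard basis of C^{n_1} (x) ... (x) C^{n_p} *)
Definition tidx p (n : 'I_p -> nat) : finType := {dffun forall i : 'I_p, 'I_(n i)}.

(* N = #|tidx n| = n_1 ... n_p ; basis vectors e_{j_1} (x) ... (x) e_{j_p} are
   ordered by the enumeration of tidx n *)
Definition Ndim p (n : 'I_p -> nat) : nat := #|tidx n|.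

Definition tensprod p (n : 'I_p -> nat) (A : forall i : 'I_p, 'M[C]_(n i))
  : 'M[C]_(Ndim n) :=
  \matrix_(r, c) \prod_(i < p)
     A i (@enum_val (tidx n) predT r i) (@enum_val (tidx n) predT c i).

Definition product_dm p (n : 'I_p -> nat) (B : 'M[C]_(Ndim n)) : Prop :=
  exists A : forall i : 'I_p, 'M[C]_(n i),
    (forall i, density (A i)) /\ B = tensprod A.

Definition pure_product_state p (n : 'I_p -> nat) (B : 'M[C]_(Ndim n)) : Prop :=
  exists A : forall i : 'I_p, 'M[C]_(n i),
    (forall i, pure_state (A i)) /\ B = tensprod A.

Definition convex_comb_of N (P : 'M[C]_N -> Prop) (m : nat) (B : 'M[C]_N) : Prop :=
  exists (w : 'I_m -> R) (Q : 'I_m -> 'M[C]_N),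
    (forall j, 0 <= w j) /\ \sum_(j < m) w j = 1 /\
    (forall j, P (Q j)) /\ B = \sum_(j < m) (w j)%:C%C *: Q j.

Definition Sigma p (n : 'I_p -> nat) : set 'M[C]_(Ndim n) :=
  [set B | exists m, convex_comb_of (@product_dm p n) m B].

Definition Sigma_pure p (n : 'I_p -> nat) (k : nat) : set 'M[C]_(Ndim n) :=
  [set B | @Sigma p n B /\
     exists m, (m <= k)%N /\ convex_comb_of (@pure_product_state p n) m B].

(* The topology of C^{N x N} = R^{2 N^2}: a set of complex matrices is viewed
   through the real-linear homeomorphism A |-> (Re A, Im A). *)
Definition realify N (A : 'M[C]_N) : 'M[R]_N * 'M[R]_N :=
  (map_mx (@complex.Re R) A, map_mx (@complex.Im R) A).

Definition cpx_compact N (S : set 'M[C]_N) : Prop := compact (@realify N @` S).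
Definition cpx_connected N (S : set 'M[C]_N) : Prop := connected (@realify N @` S).
Definition cpx_open N (S : set 'M[C]_N) : Prop := open (@realify N @` S).
Definition cpx_closure N (S : set 'M[C]_N) : set 'M[C]_N :=
  @realify N @^-1` closure (@realify N @` S).

Definition box d (a b : 'rV[R]_d) : set 'rV[R]_d :=
  [set x | forall i, a 0 i <= x 0 i <= b 0 i].

Definition lebesgue_null d (S : set 'rV[R]_d) : Prop :=
  forall eps : R, 0 < eps ->
    exists a b : nat -> 'rV[R]_d,
      (forall n i, a n 0 i <= b n 0 i) /\
      S `<=` \bigcup_n box (a n) (b n) /\
      forall m, \sum_(n < m) \prod_(i < d) (b n 0 i - a n 0 i) <= eps.

Definition tau1 N : set 'M[C]_N := [set A | hermitian A /\ \tr A = 1].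

Definition affmap N (c : 'M[C]_N) (E : 'I_(N ^ 2).-1 -> 'M[C]_N)
  (x : 'rV[R]_((N ^ 2).-1)) : 'M[C]_N :=
  c + \sum_(i < (N ^ 2).-1) (x 0 i)%:C%C *: E i.

(* (N^2-1)-dimensional Lebesgue measure zero in the affine hyperplane tau_1(N):
   the preimage under an affine bijection R^(N^2-1) -> tau_1(N) is null
   (null sets are invariant under affine bijections, so the choice of the
   affine chart is irrelevant). *)
Definition tau1_null N (S : set 'M[C]_N) : Prop :=
  exists (c : 'M[C]_N) (E : 'I_(N ^ 2).-1 -> 'M[C]_N),
    (forall x, @tau1 N (affmap c E x)) /\
    injective (affmap c E) /\
    (forall A, @tau1 N A -> exists x, affmap c E x = A) /\
    lebesgue_null (affmap c E @^-1` S).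

End QuantumDefs.

(* Main.v *)
(** Every pure state is the projection [ray v] onto the line of a nonzero vector
[v], so [Sigma_pure n k] is the set of all [mixture w v], where [w] ranges over
the simplex with [k] vertices and [v] over the [k * p] vectors of the factors.

(a) Restricting to unit vectors makes [Sigma_pure n k] the continuous image of a
compact subset of a cube. It is path connected: interpolate the weights and the
vectors linearly, having first rescaled the target vectors by phases so that no
segment meets the origin.

(b) Dividing each vector by a coordinate of largest modulus and eliminating one
weight covers [Sigma_pure n k] by finitely many Lipschitz images of the cube
[[-1, 1]^e] with [e = k - 1 + 2 k sum (n_j - 1)]. The hypothesis on [k] says
[e < N^2 - 1]. Cutting the cube into [O(M^e)] cells of side [1/M] covers the set
by as many boxes of volume [O(M^-(N^2 - 1))], of total volume [O(1/M)]. *)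

Require Import Defs.
From HB Require Import structures.
From mathcomp Require Import all_boot all_order all_algebra.
From mathcomp Require Import all_classical all_reals all_analysis.
From mathcomp Require Import complex ring lra zify.
Import numFieldNormedType.Exports.
Import Order.TTheory GRing.Theory Num.Theory.
Local Open Scope ring_scope.
Local Open Scope classical_set_scope.

Set Implicit Arguments.
Unset Strict Implicit.
Unset Printing Implicit Defensive.

(** * Pure states as projections onto lines *)

Section Rays.
Variable R : realType.
Local Notation C := (R[i]).

Definition sqnorm n (v : 'I_n -> C) : R :=
  \sum_a (complex.Re (v a) ^+ 2 + complex.Im (v a) ^+ 2).

(** With the normalization built in, any vector spanning the line may represent the state, whether a
    unit vector or one with a coordinate equal to [1]. The zero vector gives the zero matrix, as
    [0^-1 = 0]. *)
Definition ray n (v : 'I_n -> C) : 'M[C]_n :=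
  \matrix_(a, b) ((sqnorm v)^-1%:C%C * (v a * conjc (v b))).

Lemma norm_le1_sqr (y : R) : y ^+ 2 <= 1 -> `|y| <= 1.
Proof.
move=> y1; rewrite -(@ler_pXn2r _ 2) ?nnegrE //.
by rewrite real_normK ?num_real // expr1n.
Qed.

Lemma conjcM (x y : C) : conjc (x * y) = conjc x * conjc y.
Proof. exact: rmorphM. Qed.

Lemma mulc_conj (z : C) :
  z * conjc z = (complex.Re z ^+ 2 + complex.Im z ^+ 2)%:C%C.
Proof.
case: z => a b; rewrite /conjc /=; simpc.
by apply/eqP; rewrite eq_complex /=; apply/andP; split; apply/eqP; ring.
Qed.

Lemma sqnormE n (v : 'I_n -> C) : (sqnorm v)%:C%C = \sum_a v a * conjc (v a).
Proof. by rewrite /sqnorm rmorph_sum; apply: eq_bigr => a _; rewrite mulc_conj. Qed.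

Lemma sqnorm_ge0 n (v : 'I_n -> C) : 0 <= sqnorm v.
Proof. by apply: sumr_ge0 => a _; rewrite addr_ge0 ?sqr_ge0. Qed.

Lemma normsq_le_sqnorm n (v : 'I_n -> C) a :
  complex.Re (v a) ^+ 2 + complex.Im (v a) ^+ 2 <= sqnorm v.
Proof.
rewrite /sqnorm (bigD1 a) //= lerDl.
by apply: sumr_ge0 => b _; rewrite addr_ge0 ?sqr_ge0.
Qed.

Lemma sqnorm_neq0 n (v : 'I_n -> C) a : v a != 0 -> sqnorm v != 0.
Proof.
apply: contra => /eqP v0; have := normsq_le_sqnorm v a.
rewrite v0 => vle0.
have : complex.Re (v a) ^+ 2 + complex.Im (v a) ^+ 2 == 0.
  by rewrite eq_le vle0 addr_ge0 ?sqr_ge0.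
by rewrite paddr_eq0 ?sqr_ge0 // !sqrf_eq0 eq_complex.
Qed.

Lemma sqnorm_neq0P n (v : 'I_n -> C) : sqnorm v != 0 -> exists a, v a != 0.
Proof.
move=> v0; apply: contrapT => /forallNP vz; case/negP: v0.
apply/eqP/big1 => a _; have /negP := vz a; rewrite negbK => /eqP ->.
by rewrite /= expr0n addr0.
Qed.

Lemma sqnormZ n (l : C) (v : 'I_n -> C) :
  sqnorm (fun a => l * v a) =
  (complex.Re l ^+ 2 + complex.Im l ^+ 2) * sqnorm v.
Proof.
rewrite /sqnorm mulr_sumr; apply: eq_bigr => a _.
by case: l (v a) => [x y] [z t] /=; ring.
Qed.

Lemma rayZ n (l : C) (v : 'I_n -> C) : l != 0 -> ray (fun a => l * v a) = ray v.
Proof.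
move=> l0; apply/matrixP => a b; rewrite !mxE sqnormZ.
have nl0 : complex.Re l ^+ 2 + complex.Im l ^+ 2 != 0.
  by move: l0; rewrite eq_complex paddr_eq0 ?sqr_ge0 // !sqrf_eq0.
have -> : l * v a * conjc (l * v b) =
    (complex.Re l ^+ 2 + complex.Im l ^+ 2)%:C%C * (v a * conjc (v b)).
  by rewrite -mulc_conj conjcM mulrACA.
by rewrite mulrA -rmorphM invfM mulrAC mulVf // mul1r.
Qed.

Lemma trace_ray n (v : 'I_n -> C) : sqnorm v != 0 -> \tr (ray v) = 1.
Proof.
move=> v0; rewrite /mxtrace; under eq_bigr do rewrite mxE.
by rewrite -mulr_sumr -sqnormE -rmorphM /= mulVf.
Qed.

Lemma hermitian_ray n (v : 'I_n -> C) : Defs.hermitian (ray v).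
Proof.
apply/matrixP => a b; rewrite !mxE !conjcM conjcK conjc_real.
by rewrite [conjc _ * _]mulrC.
Qed.

Lemma psd_ray n (v : 'I_n -> C) : psd (ray v).
Proof.
split=> [|u]; first exact: hermitian_ray.
suff -> : (adjmx u *m ray v *m u) 0 0 = (sqnorm v)^-1%:C%C *
    ((\sum_a conjc (u a 0) * v a) * conjc (\sum_a conjc (u a 0) * v a)).
  by rewrite mulr_ge0 ?mulcJ_ge0 // ler0c invr_ge0 sqnorm_ge0.
rewrite mxE rmorph_sum /= mulr_sumr mulr_sumr; apply: eq_bigr => b _.
rewrite !mxE !mulr_suml mulr_sumr; apply: eq_bigr => a _.
by rewrite !mxE conjcM conjcK; ring.
Qed.

Lemma rank_ray n (v : 'I_n -> C) : sqnorm v != 0 -> \rank (ray v) = 1%N.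
Proof.
move=> v0; apply/eqP; rewrite eqn_leq; apply/andP; split; last first.
  rewrite lt0n mxrank_eq0; apply: contra_neq (oner_neq0 C) => ray0.
  by rewrite -(trace_ray v0) ray0 mxtrace0.
have -> : ray v = (\col_a ((sqnorm v)^-1%:C%C * v a)) *m (\row_b conjc (v b)).
  by apply/matrixP => a b; rewrite !mxE big_ord1 !mxE mulrA.
by apply: leq_trans (mxrankM_maxl _ _) (rank_leq_col _).
Qed.

Lemma density_ray n (v : 'I_n -> C) : sqnorm v != 0 -> density (ray v).
Proof. by move=> v0; split; [exact: psd_ray|exact: trace_ray]. Qed.

Lemma pure_state_ray n (v : 'I_n -> C) : sqnorm v != 0 -> pure_state (ray v).
Proof. by move=> v0; split; [exact: density_ray|exact: rank_ray]. Qed.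

Lemma rank1E n (A : 'M[C]_n) : \rank A = 1%N ->
  exists c r : 'I_n -> C, forall a b, A a b = c a * r b.
Proof.
move=> rA; have := mulmx_base A; move: (col_base A) (row_base A).
rewrite rA => c r <-; exists (fun a => c a 0), (fun b => r 0 b) => a b.
by rewrite mxE big_ord1.
Qed.

(** Rank one gives an outer product of a column and a row, symmetry makes the column a multiple of
    the conjugated row, and trace one fixes that multiple. *)
Lemma pure_stateE n (A : 'M[C]_n) : pure_state A ->
  exists2 v : 'I_n -> C, sqnorm v != 0 & A = ray v.
Proof.
case=> -[[hA _] trA] /rank1E [c [r AE]].
have [b rb0] : exists b, r b != 0.
  apply: contrapT => /forallNP r0; have /eqP := oner_neq0 C; apply.
  rewrite -trA /mxtrace big1 // => b _; rewrite AE.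
  by have /negP := r0 b; rewrite negbK => /eqP ->; rewrite mulr0.
(* Hermitian symmetry forces the column factor to be proportional to [r^*]. *)
pose l := conjc (c b) / r b; pose v a := conjc (r a).
have cE a : c a = l * v a.
  have : adjmx A a b = A a b by rewrite hA.
  rewrite !mxE !AE conjcM => /esym/(canRL (mulfK rb0)) ->.
  by rewrite /l /v mulrAC.
have v0 : sqnorm v != 0 by apply: (@sqnorm_neq0 _ _ b); rewrite conjc_eq0.
exists v => //.
have lE : l = (sqnorm v)^-1%:C%C.
  have sv0 : (sqnorm v)%:C%C != 0 by rewrite eq_complex /= eqxx andbT.
  apply: (mulIf sv0); rewrite -rmorphM /= mulVf // sqnormE mulr_sumr.
  transitivity (\tr A); last by rewrite trA.
  apply: eq_bigr => a _.
  by rewrite AE cE mulrA /v conjcK.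
by apply/matrixP => a d; rewrite AE cE lE !mxE /v conjcK mulrA.
Qed.

End Rays.

(** * Mixtures of pure product states, and rings of functions containing their entries *)

Section Mixtures.
Variables (R : realType) (p : nat) (n : 'I_p -> nat).
Local Notation C := (R[i]).

Definition simplex k (w : 'I_k -> R) : Prop :=
  (forall j, 0 <= w j) /\ \sum_j w j = 1.

Definition mixture k (w : 'I_k -> R) (v : 'I_k -> forall i, 'I_(n i) -> C) :
    'M[C]_(Ndim n) :=
  \sum_(j < k) (w j)%:C%C *: tensprod (fun i => ray (v j i)).

(** Padding with zero weights turns at most [k] states into exactly [k], so a single parameter space
    serves all ensembles. *)
Lemma Sigma_pureP k B : (0 < k)%N -> @Sigma_pure R p n k B <->
  exists (w : 'I_k -> R) (v : 'I_k -> forall i, 'I_(n i) -> C),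
    [/\ simplex w, forall j i, sqnorm (v j i) != 0 & B = mixture w v].
Proof.
move=> k0; split; last first.
  move=> [w [v [[w0 w1] v0 ->]]]; split.
    exists k, w, (fun j => tensprod (fun i => ray (v j i))); split=> //.
    split=> //; split=> // j; exists (fun i => ray (v j i)); split=> // i.
    exact: density_ray.
  exists k; split=> //; exists w, (fun j => tensprod (fun i => ray (v j i))).
  split=> //; split=> //; split=> // j.
  by exists (fun i => ray (v j i)); split=> // i; exact: pure_state_ray.
(* An empty ensemble is excluded because its weights would sum to zero. *)
move=> [_ [[|m] [lemk [w [Q [w0 [w1 [pQ ->]]]]]]]].
  by move: w1; rewrite big_ord0 => /eqP; rewrite eq_sym oner_eq0.
have vQ j : exists v : forall i, 'I_(n i) -> C,
    (forall i, sqnorm (v i) != 0) /\ Q j = tensprod (fun i => ray (v i)).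
  have [A [pA ->]] := pQ j.
  have vA i : exists v : 'I_(n i) -> C, sqnorm v != 0 /\ A i = ray v.
    by have [v v0 ->] := pure_stateE (pA i); exists v.
  exists (fun i => projT1 (cid (vA i))); split=> [i|].
    by have [] := projT2 (cid (vA i)).
  congr tensprod; apply: functional_extensionality_dep => i.
  by have [] := projT2 (cid (vA i)).
have [v vE] := choice vQ.
(* Beyond the ensemble, [inord j] falls back to the first index, whose vectors are still nonzero. *)
exists (fun j => if (j < m.+1)%N then w (inord j) else 0), (fun j => v (inord j)).
split; last 1 first.
- rewrite /mixture (eq_bigr (fun j : 'I_k => if (j < m.+1)%N then
    (w (inord j))%:C%C *: tensprod (fun i => ray (v (inord j) i)) else 0)).
    rewrite -big_mkcond /= -(big_ord_widen _ (fun j : nat =>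
      (w (inord j))%:C%C *: tensprod (fun i => ray (v (inord j) i)))) //.
    by apply: eq_bigr => j _; rewrite inord_val (vE j).2.
  by move=> j _; case: ifP => // _; rewrite scale0r.
- split=> [j|]; first by case: ifP.
  rewrite -big_mkcond /= -(big_ord_widen _ (fun j : nat => w (inord j))) //.
  by rewrite -[RHS]w1; apply: eq_bigr => j _; rewrite inord_val.
- by move=> j i; apply: (vE _).1.
Qed.

(** Entries of mixtures are studied once for an abstract ring of functions, then specialized to
    continuity at a point for (a) and to the Lipschitz property on a cube for (b). *)
Definition fun_subring X (A : (X -> R) -> Prop) : Prop :=
  [/\ forall c, A (fun=> c),
      forall f g, A f -> A g -> A (fun x => f x + g x) &
      forall f g, A f -> A g -> A (fun x => f x * g x)].

Section Subring.
Variables (X : Type) (A : (X -> R) -> Prop).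
Hypothesis subringA : fun_subring A.

Lemma fun_subring_sum I (s : seq I) (F : I -> X -> R) :
  (forall i, A (F i)) -> A (fun x => \sum_(i <- s) F i x).
Proof.
have [A0 AD _] := subringA.
move=> AF; elim: s => [|i s IHs].
  by under eq_fun do rewrite big_nil.
by under eq_fun do rewrite big_cons; apply: AD.
Qed.

Lemma fun_subringB (f g : X -> R) : A f -> A g -> A (fun x => f x - g x).
Proof.
have [A0 AD AM] := subringA.
by move=> Af Ag; under eq_fun do rewrite -mulN1r; apply: AD => //; exact: AM.
Qed.

Definition cpx_subring (f : X -> C) : Prop :=
  A (fun x => complex.Re (f x)) /\ A (fun x => complex.Im (f x)).

Lemma cpx_subringM (f g : X -> C) :
  cpx_subring f -> cpx_subring g -> cpx_subring (fun x => f x * g x).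
Proof.
have [A0 AD AM] := subringA.
move=> [Af Bf] [Ag Bg]; split.
  rewrite (_ : (fun x => _) = fun x => complex.Re (f x) * complex.Re (g x) -
    complex.Im (f x) * complex.Im (g x)); first by apply: fun_subringB; exact: AM.
  by apply/funext => x; case: (f x) (g x) => [? ?] [? ?].
rewrite (_ : (fun x => _) = fun x => complex.Re (f x) * complex.Im (g x) +
  complex.Im (f x) * complex.Re (g x)); first by apply: AD; exact: AM.
by apply/funext => x; case: (f x) (g x) => [? ?] [? ?].
Qed.

Lemma cpx_subring_real (f : X -> R) : A f -> cpx_subring (fun x => (f x)%:C%C).
Proof. by have [A0 _ _] := subringA; move=> Af; split=> //=; exact: A0. Qed.

Lemma cpx_subring_conj (f : X -> C) :
  cpx_subring f -> cpx_subring (fun x => conjc (f x)).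
Proof.
have [A0 _ AM] := subringA; move=> [Af Bf]; split.
  by rewrite (_ : (fun x => _) = fun x => complex.Re (f x)) //;
    apply/funext => x; case: (f x).
rewrite (_ : (fun x => _) = fun x => - 1 * complex.Im (f x)); first exact: AM.
by apply/funext => x; case: (f x) => ? ?; rewrite mulN1r.
Qed.

Lemma cpx_subring_sum I (s : seq I) (F : I -> X -> C) :
  (forall i, cpx_subring (F i)) -> cpx_subring (fun x => \sum_(i <- s) F i x).
Proof.
move=> AF; split.
  rewrite (_ : (fun x => _) = fun x => \sum_(i <- s) complex.Re (F i x)).
    by apply: fun_subring_sum => i; exact: (AF i).1.
  by apply/funext => x; exact: (raddf_sum (@complex.Re R : Rcomplex R -> R)).
rewrite (_ : (fun x => _) = fun x => \sum_(i <- s) complex.Im (F i x)).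
  by apply: fun_subring_sum => i; exact: (AF i).2.
by apply/funext => x; exact: (raddf_sum (@complex.Im R : Rcomplex R -> R)).
Qed.

Lemma cpx_subring_prod I (s : seq I) (F : I -> X -> C) :
  (forall i, cpx_subring (F i)) -> cpx_subring (fun x => \prod_(i <- s) F i x).
Proof.
have [A0 _ _] := subringA.
move=> AF; elim: s => [|i s IHs].
  by under eq_fun do rewrite big_nil; split; exact: A0.
by under eq_fun do rewrite big_cons; apply: cpx_subringM.
Qed.

Lemma mixtureE k (w : 'I_k -> R) (v : 'I_k -> forall i, 'I_(n i) -> C) r c :
  mixture w v r c = \sum_(j < k) (w j)%:C%C *
    \prod_(i < p) ((sqnorm (v j i))^-1%:C%C *
      (v j i (@enum_val (tidx n) predT r i) *
       conjc (v j i (@enum_val (tidx n) predT c i)))).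
Proof.
rewrite summxE; apply: eq_bigr => j _; rewrite !mxE.
by congr (_ * _); apply: eq_bigr => i _; rewrite mxE.
Qed.

Lemma fun_subring_sqnorm m (v : X -> 'I_m -> C) :
  (forall a, cpx_subring (fun x => v x a)) -> A (fun x => sqnorm (v x)).
Proof.
have [_ AD AM] := subringA.
move=> Av; apply: fun_subring_sum => a; have [Ar Ai] := Av a.
by apply: AD; exact: AM.
Qed.

(** The entries are polynomial in the weights, the coordinates, their conjugates and the inverse
    squared norms. A ring need not contain inverses, hence the third hypothesis. *)
Lemma cpx_subring_mixture k (w : X -> 'I_k -> R)
    (v : X -> 'I_k -> forall i, 'I_(n i) -> C) :
  (forall j, A (fun x => w x j)) ->
  (forall j i a, cpx_subring (fun x => v x j i a)) ->
  (forall j i, A (fun x => (sqnorm (v x j i))^-1)) ->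
  forall r c, cpx_subring (fun x => mixture (w x) (v x) r c).
Proof.
move=> Aw Av Aiv r c; under eq_fun do rewrite mixtureE.
apply: cpx_subring_sum => j; apply: cpx_subringM; first exact: cpx_subring_real.
apply: cpx_subring_prod => i.
apply: cpx_subringM; first exact: cpx_subring_real.
by apply: cpx_subringM => //; exact: cpx_subring_conj.
Qed.

End Subring.
End Mixtures.

(** * Continuity of mixtures and path connectedness *)

Section ContinuousMixtures.
Variable R : realType.
Local Notation C := (R[i]).

(** A neighbourhood of a matrix contains a product of neighbourhoods of its finitely many
    entries. *)
Lemma cvg_mx (T : Type) (F : set_system T) m n (f : T -> 'M[R]_(m, n))
    (M : 'M[R]_(m, n)) :
  Filter F -> (forall r c, (fun x => f x r c) @ F --> M r c) -> f @ F --> M.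
Proof.
move=> FF fM U [P MP PU].
apply: (filterS (P := [set x | forall rc, P rc.1 rc.2 (f x rc.1 rc.2)])).
  by move=> x Px; apply: PU => r c; exact: (Px (r, c)).
by apply: filter_forall => -[r c]; exact: fM (MP r c).
Qed.

Lemma continuous_at_fun_subring (X : topologicalType) (x : X) :
  fun_subring (fun f : X -> R => {for x, continuous f}).
Proof.
split=> [c|f g cf cg|f g cf cg]; first exact: cvg_cst.
  exact: (continuousD cf cg).
exact: (continuousM cf cg).
Qed.

Lemma continuous_realify (X : topologicalType) (x : X) N (f : X -> 'M[C]_N) :
  (forall r c, cpx_subring (fun g : X -> R => {for x, continuous g})
     (fun y => f y r c)) ->
  {for x, continuous (fun y => realify (f y))}.
Proof.
move=> cf.
have cRe : (fun y => map_mx (@complex.Re R) (f y)) @ x -->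
    map_mx (@complex.Re R) (f x).
  by apply: cvg_mx => r c; under eq_fun do rewrite mxE;
    rewrite mxE; exact: (cf r c).1.
have cIm : (fun y => map_mx (@complex.Im R) (f y)) @ x -->
    map_mx (@complex.Im R) (f x).
  by apply: cvg_mx => r c; under eq_fun do rewrite mxE;
    rewrite mxE; exact: (cf r c).2.
exact: (cvg_pair cRe cIm).
Qed.

Lemma realify_inj N : injective (@realify R N).
Proof.
move=> A B [/matrixP eqRe /matrixP eqIm]; apply/matrixP => r c.
have := eqIm r c; have := eqRe r c; rewrite !mxE.
by case: (A r c) (B r c) => [? ?] [? ?] /= -> ->.
Qed.

(** Holds because [realify] is a bijection; it carries closedness of a set over to openness of its
    complement. *)
Lemma image_realify_setC N (S : set 'M[C]_N) :
  @realify R N @` (~` S) = ~` (@realify R N @` S).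
Proof.
apply/seteqP; split=> [_ [A SA <-] [B SB /realify_inj BA]|[X Y] SXY].
  by apply: SA; rewrite -BA.
exists (\matrix_(r, c) (X r c +i* Y r c)%C).
  move=> SA; apply: SXY; eexists; first exact: SA.
  by congr (_, _); apply/matrixP => r c; rewrite !mxE.
by congr (_, _); apply/matrixP => r c; rewrite !mxE.
Qed.

(** The set is the union of the images of paths issuing from one base point, each of them
    connected. *)
Lemma connected_by_paths (T : topologicalType) (S : set T) :
  (forall x y, S x -> S y -> exists f : R -> T,
     [/\ {in `[0, 1]%classic, continuous f}, f 0 = x, f 1 = y &
         f @` `[0, 1] `<=` S]) -> connected S.
Proof.
move=> pathS; have [[x Sx]|] := pselect (S !=set0); last first.
  move/set0P/negP; rewrite negbK => /eqP ->; exact: connected0.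
have [f fP] : exists f : T -> R -> T, forall y, S y ->
    [/\ {in `[0, 1]%classic, continuous (f y)}, f y 0 = x, f y 1 = y &
        f y @` `[0, 1] `<=` S].
  have fy y : exists f : R -> T, S y ->
    [/\ {in `[0, 1]%classic, continuous f}, f 0 = x, f 1 = y &
        f @` `[0, 1] `<=` S].
    (* Outside [S] a constant path serves as default value, so that [choice] applies. *)
    have [Sy|nSy] := pselect (S y); last by exists (fun=> x).
    by have [f fP] := pathS x y Sx Sy; exists f.
  by have [f fP] := choice fy; exists f.
have -> : S = \bigcup_(y in S) (f y @` `[0, 1]).
  apply/seteqP; split=> [y Sy|y [z Sz fzy]].
    have [_ _ fy1 _] := fP _ Sy.
    by exists y => //; exists 1 => //=; rewrite in_itv /= ler01 lexx.
  by have [_ _ _] := fP _ Sz; apply.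
apply: bigcup_connected => [|y Sy].
  exists x => y Sy; have [_ fy0 _ _] := fP _ Sy.
  by exists 0 => //=; rewrite in_itv /= lexx ler01.
apply: connected_continuous_connected; first exact: segment_connected.
by apply: continuous_in_subspaceT; have [] := fP _ Sy.
Qed.

Lemma re_dotE n (v w : 'I_n -> C) :
  complex.Re (\sum_a conjc (v a) * w a) =
  \sum_a (complex.Re (v a) * complex.Re (w a) +
          complex.Im (v a) * complex.Im (w a)).
Proof.
rewrite (raddf_sum (@complex.Re R : Rcomplex R -> R)); apply: eq_bigr => a _.
by case: (v a) (w a) => [? ?] [? ?] /=; ring.
Qed.

Lemma sqnorm_segment n (v w : 'I_n -> C) (t : R) :
  sqnorm (fun a => (1 - t)%:C%C * v a + t%:C%C * w a) =
  (1 - t) ^+ 2 * sqnorm v +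
  2 * t * (1 - t) * complex.Re (\sum_a conjc (v a) * w a) + t ^+ 2 * sqnorm w.
Proof.
rewrite re_dotE /sqnorm !mulr_sumr -!big_split; apply: eq_bigr => a _ /=.
by case: (v a) (w a) => [? ?] [? ?] /=; ring.
Qed.

(* Rescaling [w] by the phase that makes its inner product with [v] nonnegative
   keeps the segment from [v] to [w] away from the origin. *)
Lemma ray_segment n (v w : 'I_n -> C) : sqnorm v != 0 -> sqnorm w != 0 ->
  exists2 w' : 'I_n -> C, ray w' = ray w & forall t, 0 <= t <= 1 ->
    sqnorm (fun a => (1 - t)%:C%C * v a + t%:C%C * w' a) != 0.
Proof.
move=> v0 w0; pose z := \sum_a conjc (v a) * w a.
(* The multiplier is the conjugate of [z], which yields the squared modulus of [z]. If [z = 0], the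
   nonzero scalar [1] replaces it. *)
have [l l0 lz] : exists2 l : C, l != 0 & 0 <= complex.Re (l * z).
  have [z0|z0] := eqVneq z 0; first by exists 1; rewrite ?oner_neq0 // z0 mulr0.
  exists (conjc z); first by rewrite conjc_eq0.
  by rewrite mulrC mulc_conj /= addr_ge0 ?sqr_ge0.
exists (fun a => l * w a); first exact: rayZ.
move=> t /andP[t0 t1]; rewrite sqnorm_segment.
have -> : \sum_a conjc (v a) * (l * w a) = l * z.
  by rewrite mulr_sumr; apply: eq_bigr => a _; rewrite mulrCA.
have w'0 : 0 < sqnorm (fun a => l * w a).
  rewrite lt_neqAle sqnorm_ge0 andbT eq_sym sqnormZ mulf_neq0 //.
  by move: l0; rewrite eq_complex paddr_eq0 ?sqr_ge0 // !sqrf_eq0.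
have vp : 0 < sqnorm v by rewrite lt_neqAle eq_sym v0 sqnorm_ge0.
(* For [t = 0] the norm is that of [v]; for [t > 0] the last term is positive and the other two are
   nonnegative. *)
have [->|tn0] := eqVneq t 0; first by rewrite gt_eqF //; nra.
have tp : 0 < t by rewrite lt_neqAle eq_sym tn0.
rewrite gt_eqF // ltr_wpDl //; last by rewrite mulr_gt0 ?exprn_gt0.
by rewrite addr_ge0 // !mulr_ge0 ?sqr_ge0 ?subr_ge0 // ltW.
Qed.

Variables (p : nat) (n : 'I_p -> nat) (k : nat).
Hypothesis k_gt0 : (0 < k)%N.

Lemma continuous_mixture (X : topologicalType) (x : X) (w : X -> 'I_k -> R)
    (v : X -> 'I_k -> forall i, 'I_(n i) -> C) :
  (forall j, {for x, continuous (fun y => w y j)}) ->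
  (forall j i a, cpx_subring (fun g : X -> R => {for x, continuous g})
     (fun y => v y j i a)) ->
  (forall j i, sqnorm (v x j i) != 0) ->
  {for x, continuous (fun y => realify (mixture (w y) (v y)))}.
Proof.
move=> cw cv v0; apply: continuous_realify => r c.
have csr := continuous_at_fun_subring x.
apply: (cpx_subring_mixture csr) => // j i.
apply: cvgV; first exact: v0.
exact: (fun_subring_sqnorm csr).
Qed.

Lemma connected_Sigma_pure : cpx_connected (@Sigma_pure R p n k).
Proof.
apply: connected_by_paths => x y [A] + <- [B] + <-.
move=> /Sigma_pureP - /(_ k_gt0) [w [v [[w0 w1] v0 ->]]].
move=> /Sigma_pureP - /(_ k_gt0) [w' [v' [[w'0 w'1] v'0 ->]]].
have uP j i : exists u : 'I_(n i) -> C, ray u = ray (v' j i) /\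
    forall t, 0 <= t <= 1 ->
    sqnorm (fun a => (1 - t)%:C%C * v j i a + t%:C%C * u a) != 0.
  by have [u uv' u0] := ray_segment (v0 j i) (v'0 j i); exists u.
pose u j i := projT1 (cid (uP j i)).
have ruE j i : ray (u j i) = ray (v' j i) by have [] := projT2 (cid (uP j i)).
have u0 j i : forall t, 0 <= t <= 1 ->
    sqnorm (fun a => (1 - t)%:C%C * v j i a + t%:C%C * u j i a) != 0.
  by have [] := projT2 (cid (uP j i)).
(* The path is linear in the parameters: a segment between the matrices themselves could require up
   to [2 * k] states. *)
pose wt (t : R) (j : 'I_k) := (1 - t) * w j + t * w' j.
pose vt (t : R) j i a := (1 - t)%:C%C * v j i a + t%:C%C * u j i a.
exists (fun t => realify (mixture (wt t) (vt t))); split.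
- move=> t; rewrite inE /= in_itv /= => t01.
  have csr := continuous_at_fun_subring (X := R) t.
  have [Acst AD AM] := csr.
  have cid : {for t, continuous (fun s : R => s)} by exact: cvg_id.
  have cB : {for t, continuous (fun s : R => 1 - s)}.
    exact: (fun_subringB csr (Acst 1) cid).
  have cline a b : {for t, continuous (fun s : R => (1 - s) * a + s * b)}.
    exact: (AD _ _ (AM _ _ cB (Acst a)) (AM _ _ cid (Acst b))).
  apply: continuous_mixture => [j|j i a|j i]; last exact: u0.
    exact: cline.
  split.
    rewrite (_ : (fun s => _) = fun s =>
      (1 - s) * complex.Re (v j i a) + s * complex.Re (u j i a)).
      exact: cline.
    apply/funext => s; rewrite /vt.
    by case: (v j i a) (u j i a) => [? ?] [? ?] /=; ring.
  rewrite (_ : (fun s => _) = fun s =>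
    (1 - s) * complex.Im (v j i a) + s * complex.Im (u j i a)).
    exact: cline.
  apply/funext => s; rewrite /vt.
  by case: (v j i a) (u j i a) => [? ?] [? ?] /=; ring.
- congr (realify (mixture _ _)).
    by apply/funext => j; rewrite /wt subr0 mul1r mul0r addr0.
  apply/funext => j; apply: functional_extensionality_dep => i.
  by apply/funext => a; rewrite /vt subr0 mul1r mul0r addr0.
(* At [t = 1] the vectors are those of [u], which agree with [v'] only through their rays. *)
- rewrite /mixture; congr realify; apply: eq_bigr => j _.
  rewrite /wt subrr mul0r mul1r add0r; congr (_ *: tensprod _).
  apply: functional_extensionality_dep => i; rewrite -ruE; congr ray.
  by apply/funext => a; rewrite /vt subrr mul0r mul1r add0r.
move=> z [t + <-]; rewrite /= in_itv /= => /andP[t0 t1].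
exists (mixture (wt t) (vt t)) => //; apply/(Sigma_pureP _ k_gt0).
exists (wt t), (vt t); split=> [|j i|//]; last by apply: u0; rewrite t0.
split=> [j|]; first by rewrite addr_ge0 ?mulr_ge0 ?subr_ge0.
by rewrite big_split /= -!mulr_sumr w1 w'1 !mulr1 subrK.
Qed.

End ContinuousMixtures.

(** * Compactness and its topological consequences *)

Section CompactSigmaPure.
Variables (R : realType) (p : nat) (n : 'I_p -> nat) (k : nat).
Hypothesis k_gt0 : (0 < k)%N.
Local Notation C := (R[i]).

(** Besides the weights, each vector coordinate has two real parameters: [false] marks its real part
    and [true] its imaginary part. The tagged pair lets the dimension vary with the factor. *)
Definition params : finType := ('I_k + 'I_k * {i : 'I_p & 'I_(n i)} * bool)%type.

Definition param_space : topologicalType :=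
  prod_topology (fun _ : params => R : topologicalType).

Definition par_weight (x : param_space) (j : 'I_k) : R := x (inl j).

Definition par_vector (x : param_space) (j : 'I_k) (i : 'I_p) (a : 'I_(n i)) : C :=
  (x (inr (j, Tagged (fun i => 'I_(n i)) a, false)) +i*
   x (inr (j, Tagged (fun i => 'I_(n i)) a, true)))%C.

Definition unit_params : set param_space :=
  [set x | [/\ forall e, -1 <= x e <= 1, simplex (par_weight x) &
               forall j i, sqnorm (@par_vector x j i) = 1]].

Lemma par_continuous (e : params) : continuous (fun x : param_space => x e).
Proof. exact: (@proj_continuous params (fun=> R : topologicalType) e). Qed.

Lemma par_vector_continuous x j i a :
  cpx_subring (fun g : param_space -> R => {for x, continuous g})
    (fun y => @par_vector y j i a).
Proof. by split; exact: par_continuous. Qed.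

(** The cube is compact by Tychonoff, and the remaining conditions are preimages of closed sets
    under continuous maps. *)
Lemma compact_unit_params : compact unit_params.
Proof.
pose cube : set param_space := [set x | forall e, `[-1, 1]%classic (x e)].
have ccube : compact cube.
  exact: (@tychonoff params (fun=> R : topologicalType) (fun=> `[-1, 1]%classic)
    (fun=> @segment_compact R (-1) 1)).
pose sqs := \bigcap_(ji in [set: 'I_k * 'I_p])
  [set x : param_space | sqnorm (@par_vector x ji.1 ji.2) = 1].
pose pos := \bigcap_(j in [set: 'I_k]) [set x : param_space | 0 <= par_weight x j].
pose tot := [set x : param_space | \sum_j par_weight x j = 1].
have -> : unit_params = cube `&` (pos `&` tot `&` sqs).
  apply/seteqP; split=> [x [xc [x0 x1] xs]|x [xc [[x0 x1] xs]]].
    split; first by move=> e; rewrite /= in_itv; exact: xc.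
    by split=> [|[j i] _ /=]; [split=> // j _; exact: x0|exact: xs].
  split=> [e|//|j i]; first by have := xc e; rewrite /= in_itv.
    by split=> // j; exact: (x0 j).
  exact: (xs (j, i)).
apply: compact_closedI => //; apply: closedI; first apply: closedI.
- apply: closed_bigI => j _.
  apply: (@closed_comp _ _ (fun x : param_space => par_weight x j) [set y | 0 <= y]).
    by move=> x _; exact: par_continuous.
  exact: closed_ge.
- apply: (@closed_comp _ _ (fun x => \sum_j par_weight x j) [set y | y = 1]).
    move=> x _.
    exact: (fun_subring_sum (F := fun j y => par_weight y j)
      (continuous_at_fun_subring R x) _ (fun j => @par_continuous (inl j) x)).
  exact: closed_eq.
apply: closed_bigI => -[j i] _ /=.
apply: (@closed_comp _ _ (fun x => sqnorm (@par_vector x j i)) [set y | y = 1]).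
  move=> x _; exact: (fun_subring_sqnorm (v := fun y => @par_vector y j i)
    (continuous_at_fun_subring R x) (@par_vector_continuous x j i)).
exact: closed_eq.
Qed.

(** Dividing a vector by its norm preserves its ray. The parameters then lie in the cube, as no
    weight exceeds the sum [1] and no coordinate exceeds the norm [1]. *)
Lemma Sigma_pure_unit_params :
  @Sigma_pure R p n k =
  (fun x => mixture (par_weight x) (@par_vector x)) @` unit_params.
Proof.
apply/seteqP; split=> [B /(Sigma_pureP _ k_gt0)|B [x [_ sx x1] <-]]; last first.
  apply/(Sigma_pureP _ k_gt0); exists (par_weight x), (@par_vector x).
  by split=> // j i; rewrite x1 oner_neq0.
move=> [w [v [[w0 w1] v0 ->]]].
pose u j i a := ((Num.sqrt (sqnorm (v j i)))^-1)%:C%C * v j i a.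
have s0 j i : 0 < Num.sqrt (sqnorm (v j i)).
  by rewrite sqrtr_gt0 lt_neqAle eq_sym v0 sqnorm_ge0.
have ru j i : ray (u j i) = ray (v j i).
  by apply: rayZ; rewrite eq_complex /= eqxx andbT invr_eq0 gt_eqF.
have u1 j i : sqnorm (u j i) = 1.
  rewrite /u sqnormZ /= expr0n addr0 exprVn sqr_sqrtr ?sqnorm_ge0 //.
  by rewrite mulVf.
pose x : param_space := fun e => match e with
  | inl j => w j
  | inr (j, existT i a, false) => complex.Re (u j i a)
  | inr (j, existT i a, true) => complex.Im (u j i a) end.
have xv : @par_vector x = u.
  apply/funext => j; apply: functional_extensionality_dep => i; apply/funext => a.
  by rewrite /par_vector /=; case: (u j i a).
exists x; last first.
  transitivity (mixture w u); first by congr mixture.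
  apply: eq_bigr => j _; congr (_ *: tensprod _).
  by apply: functional_extensionality_dep => i; rewrite ru.
split=> [|//|j i]; last by have := u1 j i; rewrite -xv.
case=> [j|[[j [i a]] b]]; rewrite -ler_norml /=.
  rewrite ger0_norm // -w1 (bigD1 j) //= lerDl.
  by apply: sumr_ge0.
have := normsq_le_sqnorm (u j i) a; rewrite u1 => le1.
by case: b; apply: norm_le1_sqr; apply: le_trans le1; rewrite ?lerDl ?lerDr sqr_ge0.
Qed.

Lemma compact_Sigma_pure : cpx_compact (@Sigma_pure R p n k).
Proof.
rewrite /cpx_compact Sigma_pure_unit_params image_comp.
apply: continuous_compact; last exact: compact_unit_params.
apply: continuous_in_subspaceT => x; rewrite inE => -[_ _ x1].
apply: continuous_mixture => [j|j i a|j i]; last by rewrite x1 oner_neq0.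
  exact: par_continuous.
exact: par_vector_continuous.
Qed.

Lemma closed_Sigma_pure : closed (@realify R _ @` @Sigma_pure R p n k).
Proof. by apply: compact_closed compact_Sigma_pure; exact: norm_hausdorff. Qed.

Lemma Sigma_pure_not_dense : @Sigma_pure R p n k <> @Sigma R p n ->
  ~ (@Sigma R p n `<=` cpx_closure (@Sigma_pure R p n k)).
Proof.
move=> neqS; rewrite /cpx_closure => subS; apply: neqS; apply/seteqP; split.
  by move=> B [].
move=> B /subS; rewrite /preimage /= -(closure_id _).1; last exact: closed_Sigma_pure.
by move=> [A SA /realify_inj <-].
Qed.

Lemma Sigma_pure_rel_open : exists U : set 'M[C]_(Ndim n),
  cpx_open U /\ @Sigma R p n `\` @Sigma_pure R p n k = U `&` @Sigma R p n.
Proof.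
exists (~` @Sigma_pure R p n k); split; last by rewrite setIC.
by rewrite /cpx_open image_realify_setC; exact/closed_openC/closed_Sigma_pure.
Qed.

End CompactSigmaPure.

(** * A covering criterion for Lebesgue null sets *)

Section NullSets.
Variable R : realType.

(** Bounds the number of boxes of nonzero side among the first [m]. The induction needs the sharper
    bound [minn m q]. *)
Lemma sum_ltn_le m q : (\sum_(n < m) (n < q) <= q)%N.
Proof.
suff : (\sum_(n < m) (n < q) <= minn m q)%N by lia.
elim: m => [|m IHm]; first by rewrite big_ord0.
rewrite big_ord_recr /=; move: IHm; set t := \sum_(n < m) _.
by rewrite /minn; do 2!case: ltnP => ?; case: (ltnP m q) => ? /=; lia.
Qed.

(** At most [K * M ^ e] boxes of side [2 * c / M] cover the set. Their total volume is at most a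
    constant times [M ^ e / M ^ d], hence at most that constant over [M]. *)
Lemma lebesgue_null_cells d e K (c : R) (S : set 'rV[R]_d) :
  (e < d)%N -> 0 <= c ->
  (forall M, (0 < M)%N -> exists (I : finType) (P : I -> set 'rV[R]_d),
    [/\ (#|I| <= K * M ^ e)%N, S `<=` \bigcup_g P g &
        forall g x y, P g x -> P g y -> forall i, `|x 0 i - y 0 i| <= c / M%:R]) ->
  lebesgue_null S.
Proof.
move=> ed c0 cells eps eps0.
pose t := K%:R * (2 * c) ^+ d.
have t0 : 0 <= t by rewrite mulr_ge0 ?exprn_ge0 ?mulr_ge0.
(* This [M] exceeds [t / eps], so the final bound [t / M] is at most [eps]. *)
pose M := (Num.truncn (t / eps)).+1.
have M0 : 0 < M%:R :> R by rewrite ltr0n.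
have [I [P [cardI SP dP]]] := cells M isT.
(* The criterion wants a sequence of boxes: indices past the last cell give [None] and a box reduced
   to the origin. *)
pose cell m : option I := omap (@enum_val I predT) (insub m : option 'I_#|I|).
pose h : R := c / M%:R.
have h0 : 0 <= h by rewrite divr_ge0 // ltW.
(* Each box is centred at a chosen point of its cell, with [0] as default for an empty cell. *)
pose a m := if cell m is Some g then xget 0 (P g) - const_mx h else 0.
pose b m := if cell m is Some g then xget 0 (P g) + const_mx h else 0.
exists a, b; split; [|split].
- move=> m i; rewrite /a /b; case: (cell m) => [g|//].
  by rewrite !mxE lerD2l; lra.
- move=> x /SP [g _ Pgx]; exists (enum_rank g) => // i.
  rewrite /a /b /cell valK /= enum_rankK !mxE.
  have := dP g x (xget 0 (P g)) Pgx (xgetPex 0 (ex_intro _ x Pgx)) i.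
  by rewrite -/h ler_distlC => /andP[? ?]; apply/andP; split; lra.
move=> m; pose V : R := (2 * h) ^+ d.
have V0 : 0 <= V by rewrite exprn_ge0 ?mulr_ge0.
apply: (@le_trans _ _ (\sum_(j < m) (j < #|I|)%N%:R * V)).
  apply: ler_sum => j _; rewrite /a /b /cell; case: insubP => [z -> _|/negPf ->] /=.
    rewrite mul1r (eq_bigr (fun=> 2 * h)); first by rewrite prodr_const card_ord.
    by move=> i _; rewrite !mxE; ring.
  (* A degenerate box has volume zero only in positive dimension, which [e < d] ensures. *)
  rewrite mul0r (eq_bigr (fun=> 0)) => [|i _]; last by rewrite mxE subrr.
  by rewrite prodr_const card_ord expr0n gtn_eqF // (leq_trans _ ed).
rewrite -mulr_suml -natr_sum.
apply: (@le_trans _ _ ((K * M ^ e)%:R * V)).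
  by rewrite ler_wpM2r // ler_nat (leq_trans (sum_ltn_le _ _)).
have -> : V = (2 * c) ^+ d / M%:R ^+ d.
  by rewrite /V /h mulrA expr_div_n.
have -> : (K * M ^ e)%:R * ((2 * c) ^+ d / M%:R ^+ d) =
    t * (M%:R ^+ e / M%:R ^+ d) :> R.
  by rewrite natrM natrX /t; ring.
apply: (@le_trans _ _ (t * M%:R^-1)).
  apply: ler_wpM2l => //; rewrite ler_pdivrMr ?exprn_gt0 //.
  rewrite -(subnKC ed) exprD exprS mulrA mulrA mulVf ?gt_eqF // mul1r.
  by apply: ler_peMr; [rewrite exprn_ge0 // ltW|rewrite exprn_ege1 // ler1n].
rewrite ler_pdivrMr // mulrC -ler_pdivrMr //.
exact/ltW/truncnS_gt.
Qed.

End NullSets.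

(** * An affine chart of the Hermitian matrices of trace one *)

Section TraceOneChart.
Variables (R : realType) (N : nat).
Hypothesis N_gt0 : (0 < N)%N.
Local Notation C := (R[i]).

Let o : 'I_N := Ordinal N_gt0.

(** The trace determines the corner entry from the others; the remaining [N ^ 2 - 1] positions index
    the real coordinates. *)
Definition offcorner : finType := {q : 'I_N * 'I_N | q != (o, o)}.

Lemma card_offcorner : (N ^ 2).-1 = #|offcorner|.
Proof. by rewrite card_sig cardC1 card_prod card_ord mulnn. Qed.

Definition cell_of (i : 'I_(N ^ 2).-1) : offcorner :=
  enum_val (cast_ord card_offcorner i).

Lemma cell_of_inj : injective cell_of.
Proof. by move=> i j /enum_val_inj /cast_ord_inj. Qed.

Lemma cell_of_surj q : exists i, cell_of i = q.
Proof.
exists (cast_ord (esym card_offcorner) (enum_rank q)).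
by rewrite /cell_of cast_ordKV enum_rankK.
Qed.

(** Away from the corner these traceless Hermitian matrices are dual to [herm_coord], which reads
    real parts on and above the diagonal and imaginary parts below it. *)
Definition herm_basis (q : 'I_N * 'I_N) : 'M[C]_N :=
  if (q.1 < q.2)%N then delta_mx q.1 q.2 + delta_mx q.2 q.1
  else if (q.2 < q.1)%N then 'i%C *: delta_mx q.1 q.2 - 'i%C *: delta_mx q.2 q.1
  else delta_mx q.1 q.1 - delta_mx o o.

Definition herm_coord (q : 'I_N * 'I_N) (A : 'M[C]_N) : R :=
  if (q.1 <= q.2)%N then complex.Re (A q.1 q.2) else complex.Im (A q.1 q.2).

Definition trace1_chart : 'rV[R]_((N ^ 2).-1) -> 'M[C]_N :=
  affmap (delta_mx o o) (fun i => herm_basis (val (cell_of i))).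

Lemma herm_coord_corner q : q != (o, o) -> herm_coord q (delta_mx o o) = 0.
Proof.
case: q => r s; rewrite xpair_eqE /herm_coord /= mxE => /negPf ->.
by case: ifP.
Qed.

(** An off-diagonal basis matrix has two mirror entries, both real or both imaginary. Reading the
    part that belongs to each side of the diagonal detects only the entry at [q']. In the diagonal
    case the corner term is invisible as [q] is not the corner. *)
Lemma herm_coord_basis q q' : q != (o, o) -> q' != (o, o) ->
  herm_coord q (herm_basis q') = (q == q')%:R.
Proof.
case: q q' => [r s] [r' s'].
rewrite !xpair_eqE /herm_coord /herm_basis /= => /negPf qo _.
case: (ltngtP r' s') => [rs'|rs'|/val_inj rs']; rewrite !mxE.
- have [rs|sr] := leqP r s.
    have -> : (r == s') && (s == r') = false.
      by apply/negP => /andP[/eqP er /eqP es]; move: rs rs'; rewrite er es; lia.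
    by case: (_ && _); rewrite /= addr0.
  have -> : (r == r') && (s == s') = false.
    by apply/negP => /andP[/eqP er /eqP es]; move: sr rs'; rewrite er es; lia.
  by case: (_ && _); rewrite /= addr0.
- have [rs|sr] := leqP r s.
    have -> : (r == r') && (s == s') = false.
      by apply/negP => /andP[/eqP er /eqP es]; move: rs rs'; rewrite er es; lia.
    by case: (_ && _); rewrite /=; ring.
  have -> : (r == s') && (s == r') = false.
    by apply/negP => /andP[/eqP er /eqP es]; move: sr rs'; rewrite er es; lia.
  by case: (_ && _); rewrite /=; ring.
rewrite -rs' qo; have [rs|sr] := leqP r s.
  by case: (_ && _); rewrite /= subr0.
have -> : (r == r') && (s == r') = false.
  by apply/negP => /andP[/eqP er /eqP es]; move: sr; rewrite er es; lia.
by rewrite /= subr0.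
Qed.

Lemma herm_coord_affine q (c : 'M[C]_N) (E : 'I_(N ^ 2).-1 -> 'M[C]_N) x :
  herm_coord q (affmap c E x) =
  herm_coord q c + \sum_i x 0 i * herm_coord q (E i).
Proof.
rewrite /herm_coord /affmap; case: ifP => _; rewrite mxE summxE.
  rewrite (raddfD (@complex.Re R : Rcomplex R -> R)).
  rewrite (raddf_sum (@complex.Re R : Rcomplex R -> R)); congr (_ + _).
  by apply: eq_bigr => i _; rewrite mxE; case: (E i _ _) => ? ? /=; ring.
rewrite (raddfD (@complex.Im R : Rcomplex R -> R)).
rewrite (raddf_sum (@complex.Im R : Rcomplex R -> R)); congr (_ + _).
by apply: eq_bigr => i _; rewrite mxE; case: (E i _ _) => ? ? /=; ring.
Qed.

Lemma herm_coord_chart i x :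
  herm_coord (val (cell_of i)) (trace1_chart x) = x 0 i.
Proof.
rewrite herm_coord_affine herm_coord_corner ?add0r; last first.
  exact: (valP (cell_of i)).
rewrite (bigD1 i) //= herm_coord_basis ?eqxx ?mulr1;
  try exact: (valP (cell_of _)).
rewrite big1 ?addr0 // => j ji; rewrite herm_coord_basis;
  try exact: (valP (cell_of _)).
by rewrite val_eqE (inj_eq cell_of_inj) eq_sym (negPf ji) mulr0.
Qed.

(** The coordinates at two mirror positions give both parts of an entry below the diagonal, symmetry
    gives the entry above, diagonal entries are real, and the trace recovers the corner. *)
Lemma herm_coord_inj (A B : 'M[C]_N) : tau1 A -> tau1 B ->
  (forall q, q != (o, o) -> herm_coord q A = herm_coord q B) -> A = B.
Proof.
move=> [hA tA] [hB tB] cAB.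
have conjE (D : 'M[C]_N) r s : Defs.hermitian D -> D r s = conjc (D s r).
  by move=> hD; rewrite -[D in LHS]hD !mxE.
have lower (r s : 'I_N) : (s < r)%N -> A r s = B r s.
  move=> sr; have rso : (r, s) != (o, o).
    by rewrite xpair_eqE; apply/negP => /andP[/eqP er /eqP es];
      move: sr; rewrite er es ltnn.
  have sro : (s, r) != (o, o) by move: rso; rewrite !xpair_eqE andbC.
  have := cAB _ sro; have := cAB _ rso.
  rewrite /herm_coord /= leqNgt sr /= (ltnW sr).
  rewrite (conjE _ s r hA) (conjE _ s r hB).
  by case: (A r s) (B r s) => [? ?] [? ?] /= -> ->.
have diag r : r != o -> A r r = B r r.
  move=> ro; have rro : (r, r) != (o, o) by rewrite xpair_eqE (negPf ro).
  have := cAB _ rro; rewrite /herm_coord /= leqnn.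
  have := conjE _ r r hA; have := conjE _ r r hB.
  case: (A r r) (B r r) => [x y] [z t] [tE] [yE] /= ->.
  by congr (_ +i* _)%C; lra.
have diago : A o o = B o o.
  have : \tr A = \tr B by rewrite tA tB.
  rewrite /mxtrace (bigD1 o) //= [RHS](bigD1 o) //=.
  by rewrite (eq_bigr (fun r => B r r)) => [/addIr //|r ro]; exact: diag.
apply/matrixP => r s; case: (ltngtP r s) => [rs|sr|/val_inj <-].
- by rewrite (conjE A) // (conjE B) // lower.
- exact: lower.
by have [->|] := eqVneq r o; [exact: diago|exact: diag].
Qed.

Lemma adjmxD (A B : 'M[C]_N) : adjmx (A + B) = adjmx A + adjmx B.
Proof. by rewrite /adjmx map_mxD linearD. Qed.

Lemma adjmx_realZ (a : R) (A : 'M[C]_N) : adjmx (a%:C%C *: A) = a%:C%C *: adjmx A.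
Proof. by apply/matrixP => r s; rewrite !mxE conjcM conjc_real. Qed.

Lemma hermitian_basis q : Defs.hermitian (herm_basis q).
Proof.
have conj_nat b : conjc (b%:R : C) = b%:R by exact: conjc_nat.
rewrite /herm_basis; case: ifP => _; [|case: ifP => _];
  apply/matrixP => r s; rewrite !mxE.
- rewrite rmorphD /= !conj_nat addrC; congr (_ + _); congr (_%:R); congr nat_of_bool.
    by rewrite andbC.
  by rewrite andbC.
- rewrite rmorphB /= !conjcM !conj_nat.
  rewrite [(s == _) && _]andbC [(s == q.2) && _]andbC.
  have -> : conjc 'i%C = - 'i%C :> C
    by rewrite /conjc; congr (_ +i* _)%C; rewrite oppr0.
  by rewrite !mulNr opprK addrC.
by rewrite rmorphB /= !conj_nat andbC [(s == o) && _]andbC.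
Qed.

Lemma trace_delta (r s : 'I_N) : \tr (delta_mx r s : 'M[C]_N) = (r == s)%:R.
Proof.
rewrite /mxtrace (bigD1 r) //= mxE eqxx /= big1 ?addr0 // => a ar.
by rewrite mxE (negPf ar).
Qed.

Lemma trace_basis q : \tr (herm_basis q) = 0.
Proof.
rewrite /herm_basis; case: ltngtP => qq.
- by rewrite raddfD /= !trace_delta -!val_eqE /= (ltn_eqF qq) (gtn_eqF qq) addr0.
- rewrite raddfB /= !mxtraceZ !trace_delta -!val_eqE /=.
  by rewrite (ltn_eqF qq) (gtn_eqF qq) subrr.
by rewrite raddfB /= !trace_delta !eqxx subrr.
Qed.

Lemma trace1_chart_tau1 x : tau1 (trace1_chart x).
Proof.
split.
  rewrite /Defs.hermitian /trace1_chart /affmap adjmxD; congr (_ + _).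
    by apply/matrixP => r s; rewrite !mxE conjc_nat andbC.
  have adjmx0 : adjmx (0 : 'M[C]_N) = 0.
    by apply/matrixP => r s; rewrite !mxE conjc0.
  rewrite (big_morph _ adjmxD adjmx0); apply: eq_bigr => i _.
  by rewrite adjmx_realZ hermitian_basis.
rewrite /trace1_chart /affmap raddfD /= trace_delta eqxx raddf_sum big1 ?addr0 //.
by move=> i _ /=; rewrite mxtraceZ trace_basis mulr0.
Qed.

Lemma trace1_chart_inj : injective trace1_chart.
Proof.
move=> x y xy; apply/rowP => i.
by rewrite -(herm_coord_chart i x) xy herm_coord_chart.
Qed.

Lemma trace1_chart_surj A : tau1 A -> exists x, trace1_chart x = A.
Proof.
move=> tA; exists (\row_i herm_coord (val (cell_of i)) A).
apply: herm_coord_inj => // [|q qo]; first exact: trace1_chart_tau1.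
have [i iE] := cell_of_surj (exist _ q qo).
by have := herm_coord_chart i (\row_i herm_coord (val (cell_of i)) A); rewrite mxE iE.
Qed.

Lemma tau1_null_of_chart (S : set 'M[C]_N) :
  lebesgue_null (trace1_chart @^-1` S) -> tau1_null S.
Proof.
move=> nullS; exists (delta_mx o o), (fun i => herm_basis (val (cell_of i))).
split; first exact: trace1_chart_tau1.
split; first exact: trace1_chart_inj.
by split; first exact: trace1_chart_surj.
Qed.

End TraceOneChart.

(** * Bounded Lipschitz functions on a cube *)

Section LipschitzOnCube.
Variables (R : realType) (E : Type).

(** The constant bounds the values as well, since the Lipschitz estimate of a product uses them. The
    number [h] stands for any bound on the sup distance. *)
Definition bounded_lipschitz (L : R) (f : (E -> R) -> R) : Prop :=
  forall (u u' : E -> R) (h : R), (forall e, `|u e| <= 1) ->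
    (forall e, `|u' e| <= 1) -> 0 <= h -> (forall e, `|u e - u' e| <= h) ->
    `|f u| <= L /\ `|f u - f u'| <= L * h.

Definition cube_lipschitz (f : (E -> R) -> R) : Prop :=
  exists2 L, 0 <= L & bounded_lipschitz L f.

Lemma cube_lipschitz_subring : fun_subring cube_lipschitz.
Proof.
split=> [c|f g [L L0 Lf] [L' L'0 Lg]|f g [L L0 Lf] [L' L'0 Lg]].
- exists `|c| => // u u' h _ _ h0 _; rewrite subrr normr0 mulr_ge0 //.
- exists (L + L'); first exact: addr_ge0.
  move=> u u' h u1 u'1 h0 uu'.
  have [fb fl] := Lf u u' h u1 u'1 h0 uu'.
have [gb gl] := Lg u u' h u1 u'1 h0 uu'.
  split; first by rewrite (le_trans (ler_normD _ _)) // lerD.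
  rewrite (_ : _ - _ = (f u - f u') + (g u - g u')); last by ring.
  by rewrite (le_trans (ler_normD _ _)) // mulrDl lerD.
(* The product rule yields two terms, each at most [L * L' * h]. *)
exists (2 * L * L'); first by rewrite !mulr_ge0.
move=> u u' h u1 u'1 h0 uu'.
have [fb fl] := Lf u u' h u1 u'1 h0 uu'.
have [gb gl] := Lg u u' h u1 u'1 h0 uu'.
have u'u' e : `|u' e - u' e| <= h by rewrite subrr normr0.
have [gb' _] := Lg u' u' h u'1 u'1 h0 u'u'.
have LL0 : 0 <= L * L' by exact: mulr_ge0.
split.
  rewrite normrM -mulrA mulr_natl mulr2n (le_trans (ler_pM _ _ fb gb)) //.
  by rewrite lerDl.
rewrite (_ : _ - _ = f u * (g u - g u') + (f u - f u') * g u'); last by ring.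
rewrite (le_trans (ler_normD _ _)) // !normrM.
rewrite (_ : 2 * L * L' * h = L * (L' * h) + (L * h) * L'); last by ring.
by rewrite lerD // ler_pM.
Qed.

Lemma cube_lipschitz_coord e : cube_lipschitz (fun u => u e).
Proof. by exists 1 => // u u' h u1 _ _ uu'; rewrite mul1r. Qed.

(** Since [f] is at least [1], inversion does not increase distances. The added [1] in the constant
    bounds the values of the inverse. *)
Lemma cube_lipschitzV f : cube_lipschitz f ->
  (forall u, (forall e, `|u e| <= 1) -> 1 <= f u) ->
  cube_lipschitz (fun u => (f u)^-1).
Proof.
move=> [L L0 Lf] f1; exists (L + 1); first exact: addr_ge0.
move=> u u' h u1 u'1 h0 uu'; have [_ fl] := Lf u u' h u1 u'1 h0 uu'.
have fu1 := f1 u u1; have fu'1 := f1 u' u'1.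
have fu0 : 0 < f u by exact: lt_le_trans fu1.
have fu'0 : 0 < f u' by exact: lt_le_trans fu'1.
have inv1 (x : R) : 1 <= x -> x^-1 <= 1.
  by move=> x1; rewrite invf_le1 // (lt_le_trans _ x1).
split; first by rewrite gtr0_norm ?invr_gt0 // (le_trans (inv1 _ fu1)) // lerDr.
have -> : (f u)^-1 - (f u')^-1 = (f u' - f u) * ((f u)^-1 * (f u')^-1).
  by field; rewrite !gt_eqF.
rewrite normrM distrC (@le_trans _ _ (L * h * 1)) //; last first.
  by rewrite mulr1 mulrDl lerDl mul1r.
apply: ler_pM => //; rewrite gtr0_norm ?mulr_gt0 ?invr_gt0 //.
by apply: mulr_ile1; [rewrite invr_ge0 ltW|rewrite invr_ge0 ltW|exact: inv1|
  exact: inv1].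
Qed.

(** The sum of finitely many constants dominates each of them. *)
Lemma cube_lipschitz_unif (I : finType) (f : I -> (E -> R) -> R) :
  (forall i, cube_lipschitz (f i)) ->
  exists2 L, 0 <= L & forall i, bounded_lipschitz L (f i).
Proof.
move=> lf; have [L LP] : exists L : I -> R,
    forall i, 0 <= L i /\ bounded_lipschitz (L i) (f i).
  have lf' i : exists L, 0 <= L /\ bounded_lipschitz L (f i).
    by have [L] := lf i; exists L.
  by have [L LP] := choice lf'; exists L.
exists (\sum_i L i) => [|i u u' h u1 u'1 h0 uu'].
  by apply: sumr_ge0 => i _; exact: (LP i).1.
have Li : L i <= \sum_i L i.
  by rewrite (bigD1 i) //= lerDl sumr_ge0 // => j _; exact: (LP j).1.
have [fb fl] := (LP i).2 u u' h u1 u'1 h0 uu'.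
by split; [exact: le_trans Li|rewrite (le_trans fl) // ler_wpM2r].
Qed.

End LipschitzOnCube.

(** * Covering by Lipschitz charts and the measure estimate *)

Section NullSigmaPure.
Variables (R : realType) (p : nat) (n : 'I_p -> nat) (k : nat).
Local Notation C := (R[i]).

(* One complex coordinate of every vector is normalized to [1], and one weight
   is determined by the others. *)
Definition chart_params : finType :=
  ('I_k + 'I_k.+1 * {i : 'I_p & 'I_(n i).-1} * bool)%type.

(** Index [ord0] carries the eliminated weight. It may be negative on the cube: the charts only have
    to cover the set. *)
Definition chart_weight (u : chart_params -> R) (j : 'I_k.+1) : R :=
  if unlift ord0 j is Some b then u (inl b) else 1 - \sum_b u (inl b).

(** Here [ch j i] is the position of the coordinate fixed to [1], and [unlift] numbers the other
    coordinates. *)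
Definition chart_vector (ch : {ffun 'I_k.+1 -> tidx n}) (u : chart_params -> R)
    (j : 'I_k.+1) (i : 'I_p) (a : 'I_(n i)) : C :=
  if unlift (ch j i) a is Some b then
    (u (inr (j, Tagged (fun i => 'I_(n i).-1) b, false)) +i*
     u (inr (j, Tagged (fun i => 'I_(n i).-1) b, true)))%C
  else 1.

Definition chart_mixture ch (u : chart_params -> R) : 'M[C]_(Ndim n) :=
  mixture (chart_weight u) (@chart_vector ch u).

Lemma normalize_max_coord m (v : 'I_m -> C) : sqnorm v != 0 ->
  exists (c : 'I_m) (v' : 'I_m -> C), [/\ ray v' = ray v, v' c = 1 &
    forall a, `|complex.Re (v' a)| <= 1 /\ `|complex.Im (v' a)| <= 1].
Proof.
move=> /sqnorm_neq0P [a0 va0].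
pose N2 (z : C) := complex.Re z ^+ 2 + complex.Im z ^+ 2.
have N2M x y : N2 (x * y) = N2 x * N2 y.
  by case: x y => [? ?] [? ?]; rewrite /N2 /=; ring.
have N2_gt0 x : x != 0 -> 0 < N2 x.
  rewrite eq_complex => x0; rewrite /N2 lt_neqAle eq_sym.
  by rewrite addr_ge0 ?sqr_ge0 // andbT paddr_eq0 ?sqr_ge0 // !sqrf_eq0.
have [c _ cmax] :=
  @Order.TotalTheory.arg_maxP _ _ _ a0 predT (fun a => N2 (v a)) isT.
(* The largest modulus is positive because some coordinate is nonzero. *)
have vc0 : v c != 0.
  have : 0 < N2 (v c) by apply: lt_le_trans (cmax a0 isT); exact: N2_gt0.
  by apply: contraTneq => ->; rewrite /N2 /= expr0n addr0 ltxx.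
exists c, (fun a => (v c)^-1 * v a); split; first by rewrite rayZ ?invr_eq0.
  by rewrite mulVf.
move=> a; have le1 : N2 ((v c)^-1 * v a) <= 1.
  rewrite -(ler_pM2l (N2_gt0 _ vc0)) -N2M mulr1 mulVKf //; exact: cmax.
by split; apply: norm_le1_sqr; apply: le_trans le1; rewrite ?lerDl ?lerDr sqr_ge0.
Qed.

(** The position of a largest coordinate depends on the vector, hence one chart for each of the
    finitely many choices [ch]. *)
Lemma Sigma_pure_chart B : @Sigma_pure R p n k.+1 B ->
  exists ch u, (forall e, `|u e| <= 1) /\ B = chart_mixture ch u.
Proof.
move=> /Sigma_pureP - /(_ isT) [w [v [[w0 w1] v0 ->]]].
have nP j i : exists cv : 'I_(n i) * ('I_(n i) -> C),
    [/\ ray cv.2 = ray (v j i), cv.2 cv.1 = 1 & forall a,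
     `|complex.Re (cv.2 a)| <= 1 /\ `|complex.Im (cv.2 a)| <= 1].
  by have [c [v' P]] := normalize_max_coord (v0 j i); exists (c, v').
pose cv j i := projT1 (cid (nP j i)).
have rcv j i : ray (cv j i).2 = ray (v j i) by have [] := projT2 (cid (nP j i)).
have cv1 j i : (cv j i).2 (cv j i).1 = 1 by have [] := projT2 (cid (nP j i)).
have cvb j i : forall a, `|complex.Re ((cv j i).2 a)| <= 1 /\
    `|complex.Im ((cv j i).2 a)| <= 1 by have [] := projT2 (cid (nP j i)).
pose ch : {ffun 'I_k.+1 -> tidx n} := [ffun j => [ffun i => (cv j i).1]].
have chE j i : ch j i = (cv j i).1 by rewrite !ffunE.
pose u : chart_params -> R := fun e => match e with
  | inl b => w (lift ord0 b)
  | inr (j, existT i b, false) => complex.Re ((cv j i).2 (lift (cv j i).1 b))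
  | inr (j, existT i b, true) => complex.Im ((cv j i).2 (lift (cv j i).1 b)) end.
exists ch, u; split.
  case=> [b|[[j [i b]] [|]]] /=; [|exact: (cvb _ _ _).2|exact: (cvb _ _ _).1].
  rewrite ger0_norm // -w1 (bigD1 (lift ord0 b)) //= lerDl.
  by apply: sumr_ge0.
have -> : chart_mixture ch u = mixture w (fun j i => (cv j i).2).
  congr mixture.
    apply/funext => j; rewrite /chart_weight; case: unliftP => [b ->//|->].
    by apply/eqP; rewrite subr_eq -w1 big_ord_recl.
  apply/funext => j; apply: functional_extensionality_dep => i; apply/funext => a.
  rewrite /chart_vector chE; case: unliftP => [b ->|->] /=; last by rewrite cv1.
  by case: ((cv j i).2 _).
apply: eq_bigr => j _; congr (_ *: tensprod _).
by apply: functional_extensionality_dep => i; rewrite rcv.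
Qed.

(** The coordinate fixed to [1] keeps every squared norm at least [1], so its inverse is Lipschitz
    too. *)
Lemma chart_mixture_lipschitz ch r c :
  cpx_subring (@cube_lipschitz R chart_params) (fun u => chart_mixture ch u r c).
Proof.
have lsub := @cube_lipschitz_subring R chart_params.
have [lcst lD lM] := lsub.
have lvec j i a :
    cpx_subring (@cube_lipschitz R chart_params) (fun u => @chart_vector ch u j i a).
  rewrite /chart_vector; case: (unlift _ _) => [b|]; last by split; exact: lcst.
  by split; exact: cube_lipschitz_coord.
apply: (cpx_subring_mixture lsub) => // [j|j i].
  rewrite /chart_weight; case: (unlift _ _) => [b|]; first exact: cube_lipschitz_coord.
  apply: (fun_subringB lsub (lcst 1)).
  apply: (fun_subring_sum lsub) => b; exact: cube_lipschitz_coord.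
apply: cube_lipschitzV; first exact: (fun_subring_sqnorm lsub).
move=> u _; have := normsq_le_sqnorm (@chart_vector ch u j i) (ch j i).
by rewrite {1 2}/chart_vector unlift_none /= expr1n expr0n addr0.
Qed.

Lemma card_chart_params :
  #|chart_params| = (k + k.+1 * (2 * \sum_(i < p) (n i).-1))%N.
Proof.
rewrite card_sum !card_prod card_tagged !card_ord card_bool sumnE big_map big_enum /=.
rewrite (eq_bigr (fun i => (n i).-1)) => [|i _]; last by rewrite card_ord.
by rewrite -mulnA [(_ * 2)%N]mulnC.
Qed.

Lemma Sigma_pure_null : (0 < Ndim n)%N ->
  (#|chart_params| < (Ndim n ^ 2).-1)%N -> tau1_null (@Sigma_pure R p n k.+1).
Proof.
move=> N0 ltd; apply: (@tau1_null_of_chart _ _ N0).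
pose coord (x : {ffun 'I_k.+1 -> tidx n} * ('I_(Ndim n) * 'I_(Ndim n))) u :=
  herm_coord x.2 (chart_mixture x.1 u).
have lcoord x : @cube_lipschitz R chart_params (coord x).
  rewrite /coord /herm_coord.
  have [lRe lIm] := chart_mixture_lipschitz x.1 x.2.1 x.2.2.
  by case: (x.2.1 <= x.2.2)%N.
have [L L0 LP] := cube_lipschitz_unif lcoord.
(* A cell is a chart together with a grid index per parameter. Shifting by [1] and scaling by [M]
   puts parameters in [[0, 2 * M]]; the endpoint [2 * M] is attained, and [3 * M] indices leave room
   for it. *)
apply: (@lebesgue_null_cells _ _ #|chart_params|
  (#|{ffun 'I_k.+1 -> tidx n}| * 3 ^ #|chart_params|) L) => // M M0.
pose I : finType :=
  ({ffun 'I_k.+1 -> tidx n} * {ffun chart_params -> 'I_(3 * M)})%type.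
have M0R : 0 < M%:R :> R by rewrite ltr0n.
exists I, (fun g : I => [set x | exists u : chart_params -> R, [/\
  forall e, `|u e| <= 1,
  forall e, Num.truncn ((u e + 1) * M%:R) = g.2 e &
  @trace1_chart R _ N0 x = chart_mixture g.1 u]]).
split.
- by rewrite card_prod [X in (_ * X <= _)%N]card_ffun card_ord expnMn mulnA.
- move=> x /Sigma_pure_chart [ch [u [u1 xu]]].
  have ult e : (Num.truncn ((u e + 1) * M%:R) < 3 * M)%N.
    have := u1 e; rewrite ler_norml => /andP[ue1 ue2].
    rewrite truncn_lt_nat; last by apply: mulr_ge0; [lra|exact: ltW].
    by rewrite natrM ltr_pM2r //; lra.
  exists (ch, [ffun e => Ordinal (ult e)]) => //=.
  by exists u; split=> // e; rewrite ffunE.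
move=> [ch g] x y [u [u1 ug xu]] [u' [u'1 u'g yu']] i /=.
(* Two scaled parameters with the same integer part differ by at most [1]. *)
have uu' e : `|u e - u' e| <= M%:R^-1.
  have /andP[t1 t2] : (g e)%:R <= (u e + 1) * M%:R < (g e).+1%:R.
    have := u1 e; rewrite ler_norml -ug => /andP[ue1 ue2].
    by apply: truncn_itv; apply: mulr_ge0; [lra|exact: ltW].
  have /andP[t'1 t'2] : (g e)%:R <= (u' e + 1) * M%:R < (g e).+1%:R.
    have := u'1 e; rewrite ler_norml -u'g => /andP[ue1 ue2].
    by apply: truncn_itv; apply: mulr_ge0; [lra|exact: ltW].
  rewrite -(ler_pM2r M0R) mulVf ?gt_eqF // -[X in _ * X](gtr0_norm M0R) -normrM.
  rewrite ler_norml mulrBl; move: t1 t2 t'1 t'2; rewrite -natr1 !mulrDl => *.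
  by apply/andP; split; lra.
(* The chart coordinates of [x] and [y] are matrix coordinates of the mixtures, so the uniform
   Lipschitz constant applies. *)
rewrite -(herm_coord_chart N0 i x) -(herm_coord_chart N0 i y) xu yu'.
have M1 : 0 <= M%:R^-1 :> R by rewrite invr_ge0 ltW.
exact: (LP (ch, val (cell_of N0 i)) u u' M%:R^-1 u1 u'1 M1 uu').2.
Qed.

End NullSigmaPure.

(** * Dimension count and conclusion *)

Lemma NdimE p (n : 'I_p -> nat) : Ndim n = (\prod_(i < p) n i)%N.
Proof.
rewrite /Ndim card_dep_ffun -[foldr _ _ _]/(foldr muln 1%N _) foldrE big_map big_enum /=.
by apply: eq_bigr => i _; rewrite card_ord.
Qed.

Theorem theorem3 (R : realType) (p : nat) (n : 'I_p -> nat) (k : nat) :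
  (1 <= p)%N -> (forall i, 0 < n i)%N -> (0 < k)%N ->
  (* (a) *)
  [/\ @Sigma_pure R p n k `<=` @Sigma R p n,
      cpx_connected (@Sigma_pure R p n k),
      cpx_compact (@Sigma_pure R p n k) &
      (@Sigma_pure R p n k <> @Sigma R p n ->
         ~ (@Sigma R p n `<=` cpx_closure (@Sigma_pure R p n k)) /\
         exists U : set 'M[R[i]]_(Ndim n),
           cpx_open U /\
           @Sigma R p n `\` @Sigma_pure R p n k = U `&` @Sigma R p n)]
  /\
  (* (b) *)
  ((k%:R : R) < (\prod_(j < p) ((n j)%:R : R) ^+ 2) /
                (1 - 2 * p%:R + \sum_(j < p) 2 * (n j)%:R) ->
   tau1_null (@Sigma_pure R p n k)).
Proof.
move=> _ n0 k0; split.
  split; [by move=> B []|exact: connected_Sigma_pure|exact: compact_Sigma_pure|].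
  by move=> neqS; split; [exact: Sigma_pure_not_dense|exact: Sigma_pure_rel_open].
have N0 : (0 < Ndim n)%N by rewrite NdimE prodn_gt0.
have -> : \prod_(j < p) ((n j)%:R : R) ^+ 2 = (Ndim n ^ 2)%:R.
  by rewrite NdimE natrX natr_prod prodrXl.
(* Positivity of each [n j] makes the denominator the natural number [1 + 2 * S], where [S] sums the
   [n j - 1]. *)
have -> : 1 - 2 * p%:R + \sum_(j < p) 2 * (n j)%:R =
    (1 + 2 * \sum_(j < p) (n j).-1)%:R :> R.
  rewrite (eq_bigr (fun j => 2 * ((n j).-1)%:R + 2)) => [|j _]; last first.
    by rewrite -[in LHS](prednK (n0 j)) -natr1; ring.
  rewrite big_split /= -mulr_sumr sumr_const card_ord natrD natrM natr_sum.
  by rewrite -mulr_natr; ring.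
rewrite ltr_pdivlMr ?ltr0n // -natrM ltr_nat.
(* With [k = k' + 1], the number of parameters [k' + 2 * k * S] equals [k * (1 + 2 * S) - 1], so the
   hypothesis places it below [N ^ 2 - 1]. *)
case: k k0 => // k' _ ltk; apply: Sigma_pure_null => //.
by rewrite card_chart_params; move: ltk; lia.
Qed.
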